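(* Given integers $N,r>0$, let $(\mathbf{X};Y)=(X_1,\dots,X_r;Y)$ be a random vector with probability generating function $\operatorname{E}[\mathbf{z}^{\mathbf{X}}q^Y]=r^{-N}H_N^{(r)}(\mathbf{z},q)$, where $H_N^{(r)}$ is the generalized $N$-th Rogers--Szeg\H{o} polynomial. Then the covariance matrix of $(\mathbf{X};Y)$ is $$\Sigma(\mathbf{X};Y)=\begin{pmatrix}\Sigma(\mathbf{X})&0\\0&\operatorname{Var}(G_{N,r})\end{pmatrix},$$ where $\Sigma(\mathbf{X})$ is the covariance matrix of the multinomial distribution (with $N$ trials and $r$ equally likely outcomes), and $G_{N,r}$ is a random variable with probability generating function $\operatorname{E}[q^{G_{N,r}}]=r^{-N}G_N^{(r)}(q)$.
   Context: $\mathbf{N}=\{0,1,2,\dots\}$. For a variable $q$, $[k]_q! = \prod_{i=1}^k \frac{1-q^i}{1-q}$. For $N\in\mathbf{N}$ and $\mathbf{k}=(k_1,\dots,k_r)\in\mathbf{N}^r$ the $q$-multinomial coefficient is $\left[{N \atop \mathbf{k}}\right]_q = \frac{[N]_q!}{[k_1]_q!\cdots[k_r]_q!}$ if $k_1+\cdots+k_r=N$, and $0$ otherwise. The generalized Rogers--Szeg\H{o} polynomial is $H_N^{(r)}(\mathbf{z},q)=\sum_{\mathbf{k}\in\mathbf{N}^r}\left[{N\atop\mathbf{k}}\right]_q\mathbf{z}^{\mathbf{k}}$, with $\mathbf{z}^{\mathbf{k}}=z_1^{k_1}\cdots z_r^{k_r}$. The generalized Galois number is $G_N^{(r)}(q)=H_N^{(r)}((1,\dots,1),q)$;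 one has $\operatorname{Var}(G_{N,r})=\frac{(r-1)(r+1)}{72r^2}N(N-1)(2N+5)$. *)

(* Defs.v *)
From HB Require Import structures.
From mathcomp Require Import all_boot all_order all_algebra.
From mathcomp Require Import all_classical all_reals all_analysis.

Set Implicit Arguments.
Unset Strict Implicit.
Unset Printing Implicit Defensive.

Import Order.TTheory GRing.Theory Num.Theory.

Local Open Scope ring_scope.

(* q-analogues are polynomials in q = 'X, so that they can also be evaluated  *)
(* at q = 1. The Euclidean quotients below are exact: see q_intM and          *)
(* q_multinomialM.                                                            *)

Definition q_int (R : fieldType) (i : nat) : {poly R} := (1 - 'X^i) %/ (1 - 'X).

Definition q_factorial (R : fieldType) (k : nat) : {poly R} :=
  \prod_(1 <= i < k.+1) q_int R i.

Definition q_multinomial (R : fieldType) (N r : nat) (k : 'I_r -> nat) :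
    {poly R} :=
  if (\sum_(i < r) k i == N)%N
  then q_factorial R N %/ \prod_(i < r) q_factorial R (k i)
  else 0.

(* The sum over k in N^r is restricted to k in {0, ..., N}^r: the             *)
(* q-multinomial coefficient vanishes for all other k.                        *)
Definition rogers_szego (R : fieldType) (N r : nat) (z : 'I_r -> R) (q : R) : R :=
  \sum_(k : {ffun 'I_r -> 'I_N.+1})
    (q_multinomial R N (fun i => k i : nat)).[q] * \prod_(i < r) z i ^+ k i.

Definition galois_number (R : fieldType) (N r : nat) (q : R) : R :=
  rogers_szego N (fun _ : 'I_r => 1) q.

Definition multinomial_pmf (R : fieldType) (N r : nat) (p : 'I_r -> R)
    (k : 'I_r -> nat) : R :=
  if (\sum_(i < r) k i == N)%N
  then N`!%:R / (\prod_(i < r) (k i)`!%:R) * \prod_(i < r) p i ^+ k i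
  else 0.

(* Entries are extended reals, as is the library's covariance.                *)
Definition covariance_mx d (T : measurableType d) (R : realType)
    (P : probability T R) (n : nat) (Z : 'I_n -> T -> R) : 'M[\bar R]_n :=
  \matrix_(i < n, j < n) covariance P (Z i) (Z j).

Definition natRV d (T : measurableType d) (R : realType) (P : probability T R)
  (X : {RV P >-> nat}) : T -> R := fun w => (X w)%:R.

Definition append_rv (T : Type) (R : Type) (r : nat) (X : 'I_r -> T -> R)
    (Y : T -> R) : 'I_(r + 1) -> T -> R :=
  fun i => match fintype.split i with inl j => X j | inr _ => Y end.

Section Exactness.
Variable R : fieldType.

Lemma q_intM i : q_int R i * (1 - 'X) = 1 - 'X^i.
Proof.
apply: divpK; rewrite -[X in _ %| X]opprB subrX1 -mulNr opprB.
exact: dvdp_mulr.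
Qed.

Lemma q_int_add a b : q_int R (a + b) = q_int R a + 'X^a * q_int R b.
Proof.
have nz : 1 - 'X != 0 :> {poly R} by rewrite -opprB oppr_eq0 polyXsubC_eq0.
apply: (mulIf nz); rewrite mulrDl -mulrA !q_intM exprD mulrBr mulr1.
by rewrite addrA subrK.
Qed.

Lemma q_factorialS k : q_factorial R k.+1 = q_factorial R k * q_int R k.+1.
Proof. by rewrite /q_factorial big_nat_recr. Qed.

Lemma q_factorial_dvd a b :
  q_factorial R a * q_factorial R b %| q_factorial R (a + b).
Proof.
have [n] := ubnP (a + b); elim: n a b => // n IH [|a] [|b] ltn.
- by rewrite /q_factorial big_geq // mulr1.
- by rewrite /q_factorial big_geq // mul1r.
- by rewrite addn0 {2}/q_factorial big_geq // mulr1.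
rewrite addSn (q_factorialS (a + _)) -[in q_int _ _]addSn q_int_add mulrDr; apply: dvdp_add.
  rewrite (q_factorialS a) mulrAC; apply: dvdp_mul => //.
  by apply: IH; move: ltn; rewrite addSn ltnS.
rewrite [X in _ %| X]mulrCA; apply: dvdp_mull.
rewrite (q_factorialS b) mulrA; apply: dvdp_mul => //.
by rewrite addnS -addSn; apply: IH; move: ltn; rewrite addnS ltnS.
Qed.

Lemma q_multinomialM (N r : nat) (k : 'I_r -> nat) :
  (\sum_(i < r) k i = N)%N ->
  q_multinomial R N k * \prod_(i < r) q_factorial R (k i) = q_factorial R N.
Proof.
move=> kN; rewrite /q_multinomial kN eqxx; apply: divpK; rewrite -{}kN.
elim/big_rec2: _ => [|i y1 y2 _ IH]; first by rewrite dvd1p.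
exact: dvdp_trans (dvdp_mul (dvdpp _) IH) (q_factorial_dvd _ _).
Qed.

End Exactness.

(* Main.v *)
Require Import Defs.
From HB Require Import structures.
From mathcomp Require Import all_boot all_order all_algebra fingroup perm.
From mathcomp Require Import all_classical all_reals all_analysis.
From mathcomp Require Import measurable_realfun lra.

Set Implicit Arguments.
Unset Strict Implicit.
Unset Printing Implicit Defensive.

Import Order.TTheory GRing.Theory Num.Theory.

Local Open Scope ring_scope.

(** No moment has to be computed. A covariance is determined by three
    variances through polarization, Var(A + B) = Var A + Var B + 2 Cov(A, B),
    and the variance of an N-valued variable is determined by its probability
    generating function (pgf) on [0, 1]. Hence Cov(A, B) depends only on the pgfs
    of A, B and A + B ([has_pgf_covariance]). Substituting powers of one variable
    t for the z_i and q in the joint generating function gives the pgf of every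
    combination sum_i c_i X_i + e Y with natural weights: it is the polynomial
    [weighted_pgf N c e] ([has_pgf_weighted_sum]).

    - Block X: at q = 1 the q-multinomial coefficients become multinomial
      coefficients, so sum_i c_i M_i has the same pgf as sum_i c_i X_i
      ([has_pgf_multinomial]), whence Cov(X_i, X_j) = Cov(M_i, M_j).

    - Entry Y: Y and G have the same pgf, hence the same variance.

    - Mixed entries ([covariance_part_statistic]): the Rogers-Szego polynomial is
      symmetric in z, so Cov(X_i, Y) does not depend on i. It is also
      homogeneous of degree N in z, so S = sum_i X_i and S + Y have the same
      pgfs as the constant N and N + Y, and therefore
      r Cov(X_i, Y) = Cov(S, Y) = Cov(N, Y) = 0.

    The pgf on [0, 1] determines the law because, for every n, it differs from
    sum_(k <= n) P(A = k) t^k by at most t^(n+1), and all coefficients of degree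
    n or less of a polynomial that is O(t^(n+1)) vanish ([poly_flat_coef0]). As
    the pgfs at hand are polynomials, the law is then supported by finitely many
    values, and this makes all moments finite. *)

(** * Polynomials that are flat at the origin *)

(** The bound is only asked for t > 0: once p(0) = 0 is known, dividing it by t
    gives the same bound for p / X, with n - 1 in place of n. *)
Lemma poly_flat_coef0 (R : realFieldType) (n : nat) (p : {poly R}) :
  (forall t : R, 0 < t <= 1 -> `|p.[t]| <= t ^+ n) ->
  forall k, (k < n)%N -> p`_k = 0.
Proof.
elim: n p => // n IH p le_p.
have pE : p = (p`_0)%:P + drop_poly 1 p * 'X.
  apply/polyP => k; rewrite coefD coefC coefMX.
  by case: k => [|k]; rewrite ?addr0 //= add0r coef_drop_poly addn1.
have [C bndC] := poly_itv_bound (drop_poly 1 p) 0 1.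
have C_ge0 : 0 <= C.
  by apply: le_trans (normr_ge0 _) (bndC 0 _); rewrite lexx ler01.
have p0 : p`_0 = 0.
  apply/eqP; rewrite -normr_eq0; apply: contraT => p0_neq0.
  have p0_gt0 : 0 < `|p`_0| by rewrite lt_def p0_neq0 normr_ge0.
  set c := `|p`_0| in p0_gt0 *.
  (* 0 < t <= 1 and (C + 1) * t < c, but |p(t)| <= t forces c <= (C + 1) * t *)
  pose t := c / (C + 1 + c).
  have den_gt0 : 0 < C + 1 + c by rewrite ltr_wpDl // addr_ge0.
  have t_gt0 : 0 < t by rewrite divr_gt0.
  have t_le1 : t <= 1 by rewrite ler_pdivrMr // mul1r lerDr addr_ge0.
  have : c <= t * (C + 1).
    have -> : c = `|p.[t] - (drop_poly 1 p).[t] * t|.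
      by rewrite {1}pE !hornerE addrK.
    apply: le_trans (ler_normB _ _) _; rewrite mulrDr mulr1 addrC lerD //.
      rewrite normrM (gtr0_norm t_gt0) mulrC ler_wpM2l ?(ltW t_gt0) //.
      by apply: bndC; rewrite ltW.
    apply: le_trans (le_p t _) _; first by rewrite t_gt0.
    by rewrite exprS ler_piMr ?(ltW t_gt0) // exprn_ile1 // ltW.
  rewrite leNgt => /negP[]; rewrite /t mulrAC ltr_pdivrMr //.
  by rewrite ltr_pM2l // ltrDl.
case=> [|k] // lt_kn.
rewrite -addn1 -coef_drop_poly.
rewrite (IH (drop_poly 1 p)) // => t /andP[t0 t1].
have := le_p t; rewrite t0 t1 => /(_ isT).
by rewrite {1}pE p0 add0r hornerMX normrM (gtr0_norm t0) exprSr ler_pM2r.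
Qed.

(** * Expectations and covariances *)

Section RandomVariables.
Context d (T : measurableType d) (R : realType) (P : probability T R).

Lemma expectation_indic_sum (I : finType) (c : I -> R) (B : I -> set T) :
  (forall i, measurable (B i)) ->
  ('E_P[fun w => (\sum_i c i * \1_(B i) w)%R] =
   (\sum_i c i * fine (P (B i)))%:E)%E.
Proof.
move=> mB; rewrite unlock.
under eq_integral do rewrite -sumEFin.
rewrite integral_sum //; last first.
  move=> i; under eq_fun do rewrite EFinM.
  by apply: integrableZl => //; exact: integrable_indic.
rewrite -sumEFin; apply: eq_bigr => i _.
under eq_integral do rewrite EFinM.
rewrite integralZl //; last exact: integrable_indic.
by rewrite integral_indic // setIT EFinM fineK // fin_num_measure.
Qed.

(** Measurability is asked of the fibers over the values [v i] and of [f \o W],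
    not of [W], so that [K] may be a function type without a sigma-algebra.
    Total mass 1 makes the other values negligible. *)
Lemma expectation_finite_range (K : Type) (W : T -> K) (I : finType)
    (v : I -> K) (p : I -> R) (f : K -> R) :
  injective v ->
  (forall i, measurable [set w | W w = v i]%classic) ->
  (forall i, P [set w | W w = v i]%classic = (p i)%:E) ->
  \sum_i p i = 1 ->
  measurable_fun setT (f \o W) ->
  ('E_P[f \o W] = (\sum_i p i * f (v i))%:E)%E.
Proof.
move=> v_inj mB PB sum_p mfW.
pose B i := [set w | W w = v i]%classic.
have -> : (\sum_i p i * f (v i))%:E =
    ('E_P[fun w => (\sum_i f (v i) * \1_(B i) w)%R])%E.
  rewrite expectation_indic_sum //; congr (_%:E).
  by apply: eq_bigr => i _; rewrite PB mulrC.
rewrite unlock; apply: ae_eq_integral => //.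
- exact/measurable_EFinP.
- apply/measurable_EFinP; apply: measurable_sum => i.
  apply: measurable_funM; first exact: measurable_cst.
  by apply: measurable_indic; exact: mB.
have mU : measurable (\bigcup_(i in [set: I]) B i)%classic.
  by apply: fin_bigcup_measurable => // i _; exact: mB.
exists (~` \bigcup_(i in [set: I]) B i)%classic; split.
- exact: measurableC.
- apply: etrans (probability_setC _ mU) _.
  rewrite measure_fin_bigcup //.
  + rewrite (fsbigE (index_enum I)) ?index_enum_uniq //=; last first.
      by move=> i; rewrite mem_index_enum.
    rewrite (eq_bigl xpredT) => [|i]; last by rewrite in_setT.
    under eq_bigr do rewrite PB.
    by rewrite sumEFin sum_p subee.
  + exact: finite_finset.
  + by move=> i j _ _ [w [/= Wi Wj]]; apply: v_inj; rewrite -Wi -Wj.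
  + by move=> i _; exact: mB.
- move=> w /= neq; apply: contra_not neq => -[i _ /= Wi] _.
  rewrite (bigD1 i) //= big1 => [|j ji].
    by rewrite addr0 indicE mem_set ?mulr1 //= Wi.
  rewrite indicE memNset ?mulr0 //= => Wj.
  by case/eqP: ji; apply: v_inj; rewrite -Wi -Wj.
Qed.

Lemma Lfun2_of_sqr (f : T -> R) :
  measurable_fun setT f -> ('E_P[fun w => (f w ^+ 2)%R] < +oo)%E ->
  f \in Lfun P 2%:E.
Proof.
move=> mf; rewrite unlock => Ef.
rewrite inE; apply/andP; split; rewrite inE //=.
rewrite /finite_norm unlock /= poweR_lty //.
under eq_integral do rewrite /= ?poweR_EFin powR_mulrn // real_normK ?num_real //.
exact: Ef.
Qed.

Lemma covariance_fin_num_Lfun2 (f g : T -> R) :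
  f \in Lfun P 2%:E -> g \in Lfun P 2%:E -> covariance P f g \is a fin_num.
Proof.
move=> f2 g2; have PT := fin_num_measure P _ measurableT.
apply: covariance_fin_num; [exact: Lfun_subset12|exact: Lfun_subset12|].
exact: Lfun2_mul_Lfun1 f2 g2.
Qed.

Lemma covariance_suml (I : finType) (f : I -> T -> R) (g : T -> R) :
  (forall i, f i \in Lfun P 2%:E) -> g \in Lfun P 2%:E ->
  (covariance P (fun w => \sum_i f i w)%R g = \sum_i covariance P (f i) g)%E.
Proof.
move=> f2 g2; rewrite -fct_sumE.
elim: (index_enum I) => [|i s IHs].
  by rewrite !big_nil; exact: covariance_cst_l.
rewrite !big_cons -IHs; apply: (covarianceDl (f2 i) _ g2).
by rewrite rpred_sum ?lee1n //= => j _; exact: f2.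
Qed.

End RandomVariables.

Lemma covariance_polarization (R : realType)
    d (T : measurableType d) (P : probability T R)
    d' (T' : measurableType d') (P' : probability T' R)
    (f g : T -> R) (f' g' : T' -> R) :
  f \in Lfun P 2%:E -> g \in Lfun P 2%:E ->
  f' \in Lfun P' 2%:E -> g' \in Lfun P' 2%:E ->
  ('V_P[f] = 'V_P'[f'])%E -> ('V_P[g] = 'V_P'[g'])%E ->
  ('V_P[(f \+ g)%R] = 'V_P'[(f' \+ g')%R])%E ->
  covariance P f g = covariance P' f' g'.
Proof.
move=> f2 g2 f'2 g'2 Vf Vg.
rewrite !varianceD // -Vf -Vg.
have c_fin := covariance_fin_num_Lfun2 f2 g2.
have c'_fin := covariance_fin_num_Lfun2 f'2 g'2.
rewrite -(fineK (variance_fin_num f2)) -(fineK (variance_fin_num g2)).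
rewrite -(fineK c_fin) -(fineK c'_fin) -!EFinM -!EFinD => -[eq_c].
congr (_%:E); lra.
Qed.

(** * Polynomial probability generating functions *)

Section ProbabilityGeneratingFunction.
Context (R : realType).

Definition has_pgf d (T : measurableType d) (P : probability T R)
    (A : T -> nat) (p : {poly R}) : Prop :=
  measurable_fun setT A /\
  forall t : R, 0 <= t <= 1 -> ('E_P[fun w => (t ^+ A w)%R] = (p.[t])%:E)%E.

Section OneVariable.
Context d (T : measurableType d) (P : probability T R).
Context (A : T -> nat) (p : {poly R}) (pgfA : has_pgf P A p).

Let measurable_fiber n : measurable [set w | A w = n]%classic.
Proof.
by rewrite -[X in measurable X]setTI; exact: (pgfA.1 measurableT [set n]%classic).
Qed.

Let measurable_comp_nat (f : nat -> R) : measurable_fun setT (f \o A).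
Proof. by apply: measurableT_comp => //; exact: pgfA.1. Qed.

Let sum_fiber (t : R) n w :
  \sum_(k < n) t ^+ k * \1_[set w | A w = k]%classic w =
  if (A w < n)%N then t ^+ A w else 0.
Proof.
case: ifP => [lt_An|ge_An].
  rewrite (bigD1 (Ordinal lt_An)) //= big1 => [|k neq_k].
    by rewrite addr0 indicE mem_set ?mulr1.
  rewrite indicE memNset ?mulr0 //= => Ak.
  by case/eqP: neq_k; apply: val_inj.
rewrite big1 // => k _; rewrite indicE memNset ?mulr0 //= => Ak.
by rewrite Ak ltn_ord in ge_An.
Qed.

(** Comparing t^A with its part on A <= n costs at most t^(n+1) on [0, 1], so
    the coefficients of [p] and the point probabilities agree up to degree n. *)
Lemma has_pgf_prob n : P [set w | A w = n]%classic = (p`_n)%:E.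
Proof.
pose a k := fine (P [set w | A w = k]%classic).
suff : (p - \poly_(k < n.+1) a k)`_n = 0.
  move/eqP; rewrite coefB coef_poly ltnSn subr_eq0 => /eqP ->.
  by rewrite fineK // fin_num_measure.
apply: (poly_flat_coef0 _ (ltnSn n)) => t /andP[t_gt0 t_le1].
have t_ge0 := ltW t_gt0.
have t01 : 0 <= t <= 1 by rewrite t_ge0.
have le_pt : (\sum_(k < n.+1) t ^+ k * a k <= p.[t])%R.
  rewrite -lee_fin -pgfA.2 // -expectation_indic_sum //.
  apply: expectation_le => //.
  - apply: measurable_sum => k.
    apply: measurable_funM; first exact: measurable_cst.
    by apply: measurable_indic; exact: measurable_fiber.
  - exact: measurable_comp_nat.
  - by move=> w; rewrite sum_fiber; case: ifP => // _; rewrite exprn_ge0.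
  - by move=> w; rewrite exprn_ge0.
  - by apply: aeW => w; rewrite sum_fiber; case: ifP => // _; rewrite exprn_ge0.
have pt_le : (p.[t] <= \sum_(k < n.+1) t ^+ k * a k + t ^+ n.+1)%R.
  (* the last indicator, that of the whole space, carries the error term t^(n+1) *)
  pose B (k : nat) := if (k <= n)%N then [set w | A w = k]%classic else setT.
  have mB (k : 'I_n.+2) : measurable (B k) by rewrite /B; case: ifP.
  have sumB w : \sum_(k < n.+2) t ^+ k * \1_(B k) w =
      (if (A w < n.+1)%N then t ^+ A w else 0) + t ^+ n.+1.
    rewrite big_ord_recr /= -sum_fiber; congr (_ + _).
      by apply: eq_bigr => k _; rewrite /B /= -ltnS ltn_ord.
    by rewrite /B ltnn indicE in_setT mulr1.
  have -> : \sum_(k < n.+1) t ^+ k * a k + t ^+ n.+1 =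
      \sum_(k < n.+2) t ^+ k * fine (P (B k)).
    rewrite [RHS]big_ord_recr /=; congr (_ + _).
      by apply: eq_bigr => k _; rewrite /B /= -ltnS ltn_ord.
    by rewrite /B ltnn probability_setT mulr1.
  rewrite -lee_fin -pgfA.2 // -expectation_indic_sum //.
  apply: expectation_le => //.
  - exact: measurable_comp_nat.
  - apply: measurable_sum => k.
    apply: measurable_funM; first exact: measurable_cst.
    by apply: measurable_indic; exact: mB.
  - by move=> w; rewrite exprn_ge0.
  - move=> w; rewrite sumB addr_ge0 ?exprn_ge0 //.
    by case: ifP => // _; rewrite exprn_ge0.
  - apply: aeW => w; rewrite sumB; case: ltnP => [_|le_nA].
      by rewrite lerDl exprn_ge0.
    by rewrite add0r ler_wiXn2l.
have Sa : (\poly_(k < n.+1) a k).[t] = \sum_(k < n.+1) t ^+ k * a k.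
  by rewrite horner_poly; apply: eq_bigr => k _; rewrite mulrC.
rewrite hornerD hornerN Sa ger0_norm ?subr_ge0 //.
by rewrite lerBlDr addrC.
Qed.

(** The value p(1) = 1 leaves no mass outside 0, ..., size p - 1. *)
Lemma has_pgf_expectation (f : nat -> R) :
  ('E_P[fun w => f (A w)] = (\sum_(n < size p) p`_n * f n)%:E)%E.
Proof.
apply: (@expectation_finite_range _ _ _ P _ A 'I_(size p)
  (@nat_of_ord _) (fun n => p`_n) f) => //.
- exact: val_inj.
- by move=> n; exact: has_pgf_prob.
have p1 : p.[1] = 1.
  apply: EFin_inj; rewrite -pgfA.2 ?lexx ?ler01 //.
  by under [X in ('E_P[X])%E]eq_fun do rewrite expr1n; exact: expectation_cst.
by rewrite -[RHS]p1 horner_coef; apply: eq_bigr => n _; rewrite expr1n mulr1.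
Qed.

Lemma has_pgf_Lfun2 : (fun w => (A w)%:R : R) \in Lfun P 2%:E.
Proof.
apply: Lfun2_of_sqr; first exact: (measurable_comp_nat (fun n => n%:R)).
by rewrite (has_pgf_expectation (fun n => n%:R ^+ 2)) ltry.
Qed.

Lemma has_pgf_addn m : has_pgf P (fun w => m + A w)%N ('X^m * p).
Proof.
split; first by apply: measurable_fun_addn => //; exact: pgfA.1.
move=> t t01; under [X in ('E_P[X])%E]eq_fun do rewrite exprD mulrC.
rewrite expectationZl ?pgfA.2 //; first by rewrite hornerM hornerXn.
apply: (Lfun_subset12 (fin_num_measure P _ measurableT)).
apply: Lfun2_of_sqr; first exact: (measurable_comp_nat (fun n => t ^+ n)).
by rewrite (has_pgf_expectation (fun n => (t ^+ n) ^+ 2)) ltry.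
Qed.

End OneVariable.

Lemma has_pgf_variance d (T : measurableType d) (P : probability T R)
    d' (T' : measurableType d') (P' : probability T' R)
    (A : T -> nat) (A' : T' -> nat) (p : {poly R}) :
  has_pgf P A p -> has_pgf P' A' p ->
  ('V_P[fun w => (A w)%:R] = 'V_P'[fun w => (A' w)%:R])%E.
Proof.
move=> pgfA pgfA'; rewrite /variance !covariance.unlock.
have E := has_pgf_expectation pgfA; have E' := has_pgf_expectation pgfA'.
pose m := \sum_(n < size p) p`_n * n%:R.
have -> : ('E_P[fun w => (A w)%:R] = m%:E)%E by exact: E (fun n => n%:R).
have -> : ('E_P'[fun w => (A' w)%:R] = m%:E)%E by exact: E' (fun n => n%:R).
exact: etrans (E (fun n => (n%:R - m) * (n%:R - m))) (esym (E' _)).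
Qed.

Lemma has_pgf_covariance d (T : measurableType d) (P : probability T R)
    d' (T' : measurableType d') (P' : probability T' R)
    (A B : T -> nat) (A' B' : T' -> nat) (p q s : {poly R}) :
  has_pgf P A p -> has_pgf P B q -> has_pgf P (fun w => A w + B w)%N s ->
  has_pgf P' A' p -> has_pgf P' B' q -> has_pgf P' (fun w => A' w + B' w)%N s ->
  covariance P (fun w => (A w)%:R) (fun w => (B w)%:R) =
  covariance P' (fun w => (A' w)%:R) (fun w => (B' w)%:R).
Proof.
move=> pA pB pAB pA' pB' pAB'.
apply: covariance_polarization.
- exact: (has_pgf_Lfun2 pA).
- exact: (has_pgf_Lfun2 pB).
- exact: (has_pgf_Lfun2 pA').
- exact: (has_pgf_Lfun2 pB').
- exact: (has_pgf_variance pA pA').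
- exact: (has_pgf_variance pB pB').
have natrD_fun (U : Type) (C D : U -> nat) :
    (fun w => (C w)%:R : R) \+ (fun w => (D w)%:R) =
    (fun w => (C w + D w)%N%:R).
  by apply/funext => w; rewrite /= natrD.
by rewrite !natrD_fun; exact: (has_pgf_variance pAB pAB').
Qed.

End ProbabilityGeneratingFunction.

(** * Rogers-Szego polynomials along monomial curves *)

Section RogersSzegoPolynomial.
Context (R : numFieldType).
Implicit Types (N r : nat).

Lemma q_int_at1 i : (q_int R i).[1] = i%:R.
Proof.
have nz : 1 - 'X != 0 :> {poly R} by rewrite -opprB oppr_eq0 polyXsubC_eq0.
have -> : q_int R i = \sum_(j < i) 'X^j.
  by apply: (mulIf nz); rewrite q_intM -[LHS]opprB subrX1 -mulNr opprB mulrC.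
rewrite horner_sum (eq_bigr (fun=> 1)) => [|j _]; last first.
  by rewrite hornerXn expr1n.
by rewrite sumr_const card_ord.
Qed.

Lemma q_factorial_at1 k : (q_factorial R k).[1] = k`!%:R.
Proof.
elim: k => [|k IHk]; first by rewrite /q_factorial big_geq // hornerC.
by rewrite q_factorialS hornerM IHk q_int_at1 -natrM mulnC -factS.
Qed.

Lemma q_multinomial_at1 N r (k : 'I_r -> nat) : (\sum_i k i = N)%N ->
  (q_multinomial R N k).[1] = N`!%:R / \prod_i (k i)`!%:R.
Proof.
move=> kN; have := congr1 (fun p => p.[1]) (q_multinomialM R kN).
rewrite /= hornerM horner_prod q_factorial_at1.
under eq_bigr do rewrite q_factorial_at1.
move=> <-; rewrite mulfK //; apply/prodf_neq0 => i _.
by rewrite pnatr_eq0 -lt0n fact_gt0.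
Qed.

Lemma q_multinomial_perm N r (s : 'S_r) (k : 'I_r -> nat) :
  q_multinomial R N (fun i => k (s i)) = q_multinomial R N k.
Proof.
have sumE : (\sum_i k i = \sum_i k (s i))%N by exact: (reindex_perm s).
have prodE : \prod_i q_factorial R (k i) = \prod_i q_factorial R (k (s i)).
  exact: (reindex_perm s).
by rewrite /q_multinomial sumE prodE.
Qed.

Lemma uniform_multinomial_pmfE N r (k : 'I_r -> nat) :
  multinomial_pmf N (fun=> r%:R^-1) k =
  r%:R ^- N * (q_multinomial R N k).[1].
Proof.
rewrite /multinomial_pmf; case: eqP => [kN|/eqP/negbTE kN].
  by rewrite q_multinomial_at1 // prodrXr kN exprVn mulrC.
by rewrite /q_multinomial kN hornerC mulr0.
Qed.

(** The normalized Rogers-Szego polynomial along the curve z_i = t^(c i),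
    q = t^e, as a polynomial in t. *)
Definition weighted_pgf N r (c : 'I_r -> nat) (e : nat) : {poly R} :=
  r%:R ^- N *: \sum_(k : {ffun 'I_r -> 'I_N.+1})
    (q_multinomial R N (fun i => k i) \Po 'X^e) * 'X^(\sum_i c i * k i).

Lemma horner_weighted_pgf N r (c : 'I_r -> nat) e t :
  (weighted_pgf N c e).[t] =
  r%:R ^- N * rogers_szego N (fun i => t ^+ c i) (t ^+ e).
Proof.
rewrite hornerZ horner_sum; congr (_ * _); apply: eq_bigr => k _.
rewrite hornerM horner_comp !hornerXn -prodrXr.
by under eq_bigr do rewrite exprM.
Qed.

(** The Rogers-Szego polynomial is symmetric in z, since a q-multinomial
    coefficient does not depend on the order of its lower entries. *)
Lemma weighted_pgf_perm N r (s : 'S_r) (c : 'I_r -> nat) e :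
  weighted_pgf N (fun i => c (s i)) e = weighted_pgf N c e.
Proof.
congr (_ *: _).
have s_bij : bijective (fun k : {ffun 'I_r -> 'I_N.+1} => [ffun i => k (s i)]).
  exists (fun k : {ffun _ -> _} => [ffun i => k (s^-1%g i)]) => k; apply/ffunP => i.
    by rewrite !ffunE permKV.
  by rewrite !ffunE permK.
rewrite (reindex _ (onW_bij _ s_bij)) /=; apply: eq_bigr => k _; congr (_ * _).
  rewrite -(q_multinomial_perm N s (fun i => k i)).
  by under [X in q_multinomial _ _ X]eq_fun do rewrite ffunE.
congr ('X^_); rewrite [RHS](reindex_perm s) /=.
by apply: eq_bigr => i _; rewrite ffunE.
Qed.

(** Homogeneity in z: only the k with sum N contribute. *)
Lemma weighted_pgf_const1 N r e :
  weighted_pgf N (fun _ : 'I_r => 1%N) e =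
  'X^N * weighted_pgf N (fun _ : 'I_r => 0%N) e.
Proof.
rewrite /weighted_pgf -scalerAr mulr_sumr; congr (_ *: _).
apply: eq_bigr => k _; rewrite mulrCA -exprD; under eq_bigr do rewrite mul1n.
under [in RHS]eq_bigr do rewrite mul0n.
rewrite sum_nat_const muln0 addn0.
case: (eqVneq (\sum_i k i)%N N) => [-> //|/negbTE kN].
by rewrite /q_multinomial kN comp_poly0 !mul0r.
Qed.

End RogersSzegoPolynomial.

(** * Generating functions of weighted sums *)

Section WeightedSums.
Context (R : realType) d (T : measurableType d) (P : probability T R).
Context (N r : nat).

Lemma measurable_weighted_sum (X : 'I_r -> {RV P >-> nat}) (c : 'I_r -> nat) :
  measurable_fun setT (fun w => \sum_i c i * X i w)%N.
Proof.
elim: (index_enum 'I_r) => [|i s IHs].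
  by under eq_fun do rewrite big_nil; exact: measurable_cst.
under eq_fun do rewrite big_cons.
apply: measurable_fun_addn => //.
by apply: (@measurableT_comp _ _ _ _ _ _ (muln (c i))) => //.
Qed.

Lemma has_pgf_weighted_sum (X : 'I_r -> {RV P >-> nat}) (Y : {RV P >-> nat}) :
  (forall (z : 'I_r -> R) (q : R),
    (forall i, 0 <= z i <= 1) -> 0 <= q <= 1 ->
    ('E_P[fun w => ((\prod_(i < r) z i ^+ X i w) * q ^+ Y w)%R] =
      (r%:R ^- N * rogers_szego N z q)%:E)%E) ->
  forall c e, has_pgf P (fun w => \sum_i c i * X i w + e * Y w)%N
                        (weighted_pgf R N c e).
Proof.
move=> hXY c e; split.
  apply: measurable_fun_addn; first exact: measurable_weighted_sum.
  apply: (@measurableT_comp _ _ _ _ _ _ (muln e)) => //.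
move=> t t01.
have tX01 n : 0 <= t ^+ n <= 1.
  by case/andP: t01 => t0 t1; rewrite exprn_ge0 // exprn_ile1.
rewrite horner_weighted_pgf -hXY //; congr expectation; apply/funext => w.
by rewrite exprD exprM -prodrXr; under eq_bigr do rewrite exprM.
Qed.

(** The hypothesis on the value at 1 says that the multinomial probabilities sum
    to 1, so that the vector has no mass outside {0, ..., N}^r. *)
Lemma has_pgf_multinomial (M : 'I_r -> {RV P >-> nat}) :
  (forall k : 'I_r -> nat,
    (P [set w | forall i, M i w = k i]%classic =
      (multinomial_pmf N (fun=> r%:R^-1) k)%:E)%E) ->
  (weighted_pgf R N (fun _ : 'I_r => 0%N) 0%N).[1] = 1 ->
  forall c, has_pgf P (fun w => \sum_i c i * M i w)%N (weighted_pgf R N c 0%N).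
Proof.
move=> hM mass1 c; split; first exact: measurable_weighted_sum.
pose v (k : {ffun 'I_r -> 'I_N.+1}) i : nat := k i.
have fiberE k : [set w | (fun i => M i w) = v k]%classic =
    [set w | forall i, M i w = v k i]%classic.
  by apply/seteqP; split => w /=; [move=> <-|move=> ?; exact/funext].
move=> t t01.
pose f (k : 'I_r -> nat) := t ^+ (\sum_i c i * k i).
pose p (k : {ffun 'I_r -> 'I_N.+1}) :=
  multinomial_pmf N (fun=> r%:R^-1 : R) (v k).
transitivity (\sum_k p k * f (v k))%:E.
  apply: (@expectation_finite_range _ _ _ P _ (fun w i => M i w) _ v p f).
  - move=> k l kl; apply/ffunP => i; apply: val_inj.
    exact: (congr1 (fun g => g i) kl).
  - move=> k; rewrite fiberE.
    rewrite (_ : [set _ | _]%classic =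
       (\bigcap_(i in [set: 'I_r]) [set w | M i w = v k i])%classic); last first.
      apply/seteqP; split => w /= Mk; first by move=> i _; exact: Mk.
      by move=> i; exact: Mk.
    apply: fin_bigcap_measurable; first exact: finite_finset.
    by move=> i _; apply: (@measurable_funPTI _ _ _ _ (M i) [set v k i]%classic).
  - by move=> k; rewrite fiberE hM.
  - rewrite -mass1 horner_weighted_pgf mulr_sumr; apply: eq_bigr => k _.
    rewrite /p uniform_multinomial_pmfE expr0 big1 ?mulr1 // => i _.
    by rewrite !expr1n.
  - apply: (@measurableT_comp _ _ _ _ _ _ (fun n => t ^+ n)) => //.
    exact: measurable_weighted_sum.
congr (_%:E); rewrite horner_weighted_pgf mulr_sumr; apply: eq_bigr => k _.
rewrite /p /f uniform_multinomial_pmfE expr0 -mulrA -prodrXr.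
congr (_ * (_ * _)).
by apply: eq_bigr => i _; rewrite exprM.
Qed.

End WeightedSums.

(** * Covariances of the parts and of the statistic *)

Section UnitWeights.
Context (r : nat).
Implicit Types (i j : 'I_r) (x : 'I_r -> nat).

Definition unit_weight i : 'I_r -> nat := fun j => j == i.

Lemma sum_unit_weight x i : (\sum_j unit_weight i j * x j)%N = x i.
Proof.
rewrite (bigD1 i) //= big1 => [|j ji]; rewrite /unit_weight.
  by rewrite eqxx mul1n addn0.
by rewrite (negbTE ji).
Qed.

Lemma sum_unit_weight2 x i j :
  (\sum_l (unit_weight i l + unit_weight j l) * x l)%N = (x i + x j)%N.
Proof.
by under eq_bigr do rewrite mulnDl; rewrite big_split /= !sum_unit_weight.
Qed.

Lemma sum_zero_weight x : (\sum_(j < r) 0 * x j)%N = 0%N.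
Proof. by rewrite big1 // => j _; rewrite mul0n. Qed.

End UnitWeights.

Section Covariances.
Context (R : realType) (N r : nat).

(** Unit weights single out X_i and X_j, and the sum of two of them X_i + X_j:
    these are the three variables that polarization needs. *)
Lemma covariance_parts d (T : measurableType d) (P : probability T R)
    d' (T' : measurableType d') (P' : probability T' R)
    (X : 'I_r -> {RV P >-> nat}) (M : 'I_r -> {RV P' >-> nat})
    (p : ('I_r -> nat) -> {poly R}) :
  (forall c, has_pgf P (fun w => \sum_i c i * X i w)%N (p c)) ->
  (forall c, has_pgf P' (fun w => \sum_i c i * M i w)%N (p c)) ->
  forall i j, covariance P (natRV (X i)) (natRV (X j)) =
              covariance P' (natRV (M i)) (natRV (M j)).
Proof.
move=> pgfX pgfM i j.
have pgf1 d0 (T0 : measurableType d0) (P0 : probability T0 R)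
    (Z : 'I_r -> {RV P0 >-> nat}) :
    (forall c, has_pgf P0 (fun w => \sum_i c i * Z i w)%N (p c)) ->
    forall l, has_pgf P0 (Z l) (p (unit_weight l)).
  move=> pgfZ l; have := pgfZ (unit_weight l).
  by under eq_fun do rewrite sum_unit_weight.
have pgf2 d0 (T0 : measurableType d0) (P0 : probability T0 R)
    (Z : 'I_r -> {RV P0 >-> nat}) :
    (forall c, has_pgf P0 (fun w => \sum_i c i * Z i w)%N (p c)) ->
    has_pgf P0 (fun w => Z i w + Z j w)%N
      (p (fun l => unit_weight i l + unit_weight j l)%N).
  move=> pgfZ; have := pgfZ (fun l => unit_weight i l + unit_weight j l)%N.
  by under eq_fun do rewrite sum_unit_weight2.
exact: (has_pgf_covariance (pgf1 _ _ _ _ pgfX i) (pgf1 _ _ _ _ pgfX j)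
  (pgf2 _ _ _ _ pgfX) (pgf1 _ _ _ _ pgfM i) (pgf1 _ _ _ _ pgfM j)
  (pgf2 _ _ _ _ pgfM)).
Qed.

Context d (T : measurableType d) (P : probability T R).
Context (X : 'I_r -> {RV P >-> nat}) (Y : {RV P >-> nat}).
Context (pgfXY : forall c e,
  has_pgf P (fun w => \sum_i c i * X i w + e * Y w)%N (weighted_pgf R N c e)).

Let pgfX i : has_pgf P (X i) (weighted_pgf R N (unit_weight i) 0%N).
Proof.
have := pgfXY (unit_weight i) 0%N.
by under eq_fun do rewrite sum_unit_weight mul0n addn0.
Qed.

Let pgfXiY i :
  has_pgf P (fun w => X i w + Y w)%N (weighted_pgf R N (unit_weight i) 1%N).
Proof.
have := pgfXY (unit_weight i) 1%N.
by under eq_fun do rewrite sum_unit_weight mul1n.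
Qed.

Lemma has_pgf_statistic :
  has_pgf P Y (weighted_pgf R N (fun _ : 'I_r => 0%N) 1%N).
Proof.
have := pgfXY (fun=> 0%N) 1%N.
by under eq_fun do rewrite sum_zero_weight mul1n add0n.
Qed.

Let covariance_part_sym i j :
  covariance P (natRV (X j)) (natRV Y) = covariance P (natRV (X i)) (natRV Y).
Proof.
have wt_perm e : weighted_pgf R N (unit_weight j) e =
                 weighted_pgf R N (unit_weight i) e.
  rewrite -[RHS](weighted_pgf_perm R N (tperm i j) (unit_weight i) e).
  congr weighted_pgf; apply/funext => l.
  by rewrite /unit_weight (can2_eq (tpermK _ _) (tpermK _ _)) tpermL.
apply: (has_pgf_covariance (pgfX j) has_pgf_statistic (pgfXiY j)
                           _ has_pgf_statistic _).
  by rewrite wt_perm.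
by rewrite wt_perm.
Qed.

(** By homogeneity in z, the sum S of the parts and S + Y have the same pgfs as
    the constant N and N + Y, so S covaries with Y as N does. *)
Let covariance_sum_parts :
  covariance P (fun w => \sum_j natRV (X j) w)%R (natRV Y) = 0%E.
Proof.
have -> : (fun w => \sum_j natRV (X j) w) = fun w => (\sum_j X j w)%N%:R.
  by apply/funext => w; rewrite natr_sum.
rewrite -(covariance_cst_l P N%:R (natRV Y)).
have pgfS e : has_pgf P (fun w => \sum_j X j w + e * Y w)%N
    ('X^N * weighted_pgf R N (fun _ : 'I_r => 0%N) e).
  rewrite -weighted_pgf_const1; have := pgfXY (fun=> 1%N) e.
  by under eq_fun do under eq_bigr do rewrite mul1n.
have pgfS0 : has_pgf P (fun w => \sum_j X j w)%N
    ('X^N * weighted_pgf R N (fun _ : 'I_r => 0%N) 0%N).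
  by have := pgfS 0%N; under eq_fun do rewrite mul0n addn0.
have pgfSY : has_pgf P (fun w => \sum_j X j w + Y w)%N
    ('X^N * weighted_pgf R N (fun _ : 'I_r => 0%N) 1%N).
  by have := pgfS 1%N; under eq_fun do rewrite mul1n.
have pgf0 : has_pgf P (fun=> 0%N) (weighted_pgf R N (fun _ : 'I_r => 0%N) 0%N).
  have := pgfXY (fun=> 0%N) 0%N.
  by under eq_fun do rewrite sum_zero_weight mul0n.
have pgfN : has_pgf P (fun=> N)
    ('X^N * weighted_pgf R N (fun _ : 'I_r => 0%N) 0%N).
  by have := has_pgf_addn pgf0 N; under eq_fun do rewrite addn0.
exact: (has_pgf_covariance pgfS0 has_pgf_statistic pgfSY
                           pgfN has_pgf_statistic
  (has_pgf_addn has_pgf_statistic N)).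
Qed.

(** All r covariances are equal by symmetry, and they sum to Cov(N, Y) = 0. *)
Lemma covariance_part_statistic i : covariance P (natRV (X i)) (natRV Y) = 0%E.
Proof.
have X2 j : natRV (X j) \in Lfun P 2%:E := has_pgf_Lfun2 (pgfX j).
have Y2 : natRV Y \in Lfun P 2%:E := has_pgf_Lfun2 has_pgf_statistic.
have := covariance_sum_parts; rewrite covariance_suml //.
rewrite (eq_bigr _ (fun j _ => covariance_part_sym i j)).
rewrite -(fineK (covariance_fin_num_Lfun2 (X2 i) Y2)) sumEFin.
rewrite sumr_const card_ord => -[/eqP].
have r_gt0 : (0 < r)%N by exact: leq_ltn_trans (ltn_ord i).
by rewrite -mulr_natr mulf_eq0 pnatr_eq0 (gtn_eqF r_gt0) orbF => /eqP ->.
Qed.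

End Covariances.

Theorem corollary5p1 (R : realType) (N r : nat) (hN : (0 < N)%N) (hr : (0 < r)%N)
  (* the random vector (X; Y) *)
  (d : measure_display) (T : measurableType d) (P : probability T R)
  (X : 'I_r -> {RV P >-> nat}) (Y : {RV P >-> nat})
  (hXY : forall (z : 'I_r -> R) (q : R),
    (forall i, 0 <= z i <= 1) -> 0 <= q <= 1 ->
    ('E_P[fun w => ((\prod_(i < r) z i ^+ X i w) * q ^+ Y w)%R] =
      (r%:R ^- N * rogers_szego N z q)%:E)%E)
  (* a multinomial random vector, N trials with r equally likely outcomes *)
  (d1 : measure_display) (T1 : measurableType d1) (P1 : probability T1 R)
  (M : 'I_r -> {RV P1 >-> nat})
  (hM : forall k : 'I_r -> nat,
    (P1 [set w | forall i, M i w = k i]%classic =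
      (multinomial_pmf N (fun=> r%:R^-1) k)%:E)%E)
  (* the random variable G_{N,r} *)
  (d2 : measure_display) (T2 : measurableType d2) (P2 : probability T2 R)
  (G : {RV P2 >-> nat})
  (hG : forall q : R, 0 <= q <= 1 ->
    ('E_P2[fun w => (q ^+ G w)%R] = (r%:R ^- N * galois_number N r q)%:E)%E) :
  covariance_mx P (append_rv (fun i => natRV (X i)) (natRV Y)) =
  block_mx (covariance_mx P1 (fun i => natRV (M i))) (const_mx 0%E)
           (const_mx 0%E)                            (const_mx 'V_P2[natRV G]%E).
Proof.
have pgfXY c e := has_pgf_weighted_sum hXY c e.
(* at z = 1 and q = 1 the generating function is the expectation of 1 *)
have mass1 : (weighted_pgf R N (fun _ : 'I_r => 0%N) 0%N).[1] = 1.
  apply: EFin_inj; rewrite -(pgfXY (fun=> 0%N) 0%N).2 ?lexx ?ler01 //.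
  by under [X in ('E_P[X])%E]eq_fun do rewrite expr1n; exact: expectation_cst.
have pgfX c : has_pgf P (fun w => \sum_i c i * X i w)%N (weighted_pgf R N c 0%N).
  by have := pgfXY c 0%N; under eq_fun do rewrite mul0n addn0.
have pgfM c := has_pgf_multinomial hM mass1 c.
have pgfG : has_pgf P2 G (weighted_pgf R N (fun _ : 'I_r => 0%N) 1%N).
  split=> [|q q01]; first exact: measurable_funPT.
  by rewrite hG // horner_weighted_pgf /galois_number expr1.
have covX := covariance_parts pgfX pgfM.
have covXY := covariance_part_statistic pgfXY.
apply/matrixP => i j; rewrite !mxE /append_rv.
case: (fintype.split i) => i'; rewrite !mxE;
  case: (fintype.split j) => j'; rewrite !mxE //.
- by rewrite covarianceC.
- exact: has_pgf_variance (has_pgf_statistic pgfXY) pgfG.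
Qed.
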